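(* Let $\mathbb{Z}\,\mathrm{wr}\,\mathbb{Z}$ have its standard generating set $\{a,b\}$, and for $m\in\mathbb{N}$, $m\ge 1$, let $H_m=\langle b, [\cdots[[a,b],b],\cdots,b]\rangle$, where the commutator is $(m-1)$-fold (so that it is $a$ when $m=1$). Then $H_m$ is $(m-1)$-subnormal in $\mathbb{Z}\,\mathrm{wr}\,\mathbb{Z}$, is isomorphic to the whole group $\mathbb{Z}\,\mathrm{wr}\,\mathbb{Z}$, and has distortion $\Delta_{H_m}^{\mathbb{Z}\,\mathrm{wr}\,\mathbb{Z}}(l)\approx l^m$. In particular, the subgroup $\langle b,[a,b]\rangle$ is normal and has quadratic distortion, i.e. distortion equivalent to $l^2$.
   Context: $\mathbb{Z}\,\mathrm{wr}\,\mathbb{Z}=W\rtimes\langle b\rangle$ is the restricted wreath product, where $W$ is free abelian with basis $\{b^iab^{-i}: i\in\mathbb{Z}\}$; $a$ generates the passive infinite cyclic group and $b$ the active one. The commutator is $[x,y]=xyx^{-1}y^{-1}$. A subgroup $H$ of $G$ is $r$-subnormal if there is a chain $H=K_r\trianglelefteq K_{r-1}\trianglelefteq\cdots\trianglelefteq K_0=G$. For a group $G$ with finite generating set $T$ and a subgroup $H$ with finite generating set $S$, the distortion function is $\Delta_H^G(l)=\max\{|w|_S : w\in H, |w|_T\le l\}$. For non-decreasing functions $f,g$ on the nonnegative integers, $f\preceq g$ means there is an integer $C>0$ with $f(l)\le Cg(Cl)$ for all $l\ge 0$; $f\approx g$ means $f\preceq g$ and $g\preceq f$. *)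

(* Defs.v *)
From HB Require Import structures.
From mathcomp Require Import all_boot all_order all_algebra.
From mathcomp Require Import finmap boolp classical_sets functions cardinality.
From mathcomp Require Import monalg.

Set Implicit Arguments.
Unset Strict Implicit.
Unset Printing Implicit Defensive.

Import GRing.Theory.

Local Open Scope classical_set_scope.
Local Open Scope ring_scope.

(* {malg int} is the free abelian group on the set int; its basis element
   << k >> stands for b^k a b^-k, so conjugation by b^i is << k >> |-> << i + k >>. *)
Definition shift (i : int) (w : {malg int}) : {malg int} :=
  \sum_(k <- msupp w) << w@_k *g i + k >>.

Lemma mcoeff_shift i w k : (shift i w)@_k = w@_(k - i).
Proof.
rewrite [in RHS](monalgE w) /shift !raddf_sum /=.
by apply: eq_bigr => j _; rewrite !mcoeffU -[j == _](inj_eq (addrI i)) subrKC.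
Qed.

Lemma shift0 w : shift 0 w = w.
Proof. by apply/malgP => k; rewrite mcoeff_shift subr0. Qed.

Lemma shiftD i j w : shift (i + j) w = shift i (shift j w).
Proof. by apply/malgP => k; rewrite !mcoeff_shift opprD addrA. Qed.

Lemma shift_is_additive i u v : shift i (u + v) = shift i u + shift i v.
Proof. by apply/malgP => k; rewrite !(mcoeff_shift, mcoeffD). Qed.

Lemma shiftN i w : shift i (- w) = - shift i w.
Proof. by apply/malgP => k; rewrite !(mcoeff_shift, mcoeffN). Qed.

Lemma shiftU i k c : shift i << c *g k >> = << c *g i + k >>.
Proof.
apply/malgP => j; rewrite mcoeff_shift !mcoeffU.
by rewrite -[k == _](inj_eq (addrI i)) subrKC.
Qed.

(* Wr w i is the element w b^i of the semidirect product of W and <b>. *)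
Record ZwrZ : Type := Wr { passive : {malg int}; active : int }.

Definition pair_of_ZwrZ (g : ZwrZ) := (passive g, active g).
Definition ZwrZ_of_pair p : ZwrZ := Wr p.1 p.2.
Lemma pair_of_ZwrZK : cancel pair_of_ZwrZ ZwrZ_of_pair. Proof. by case. Qed.

HB.instance Definition _ := Choice.copy ZwrZ (can_type pair_of_ZwrZK).

Definition wr_one : ZwrZ := Wr 0 0.
Definition wr_mul (g h : ZwrZ) : ZwrZ :=
  Wr (passive g + shift (active g) (passive h)) (active g + active h).
Definition wr_inv (g : ZwrZ) : ZwrZ :=
  Wr (- shift (- active g) (passive g)) (- active g).

Lemma wr_mulA : associative wr_mul.
Proof.
move=> [u i] [v j] [w k].
by rewrite /wr_mul /= shift_is_additive shiftD !addrA.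
Qed.

Lemma wr_mul1 : left_id wr_one wr_mul.
Proof. by move=> [w i]; rewrite /wr_mul /= shift0 !add0r. Qed.

Lemma wr_mulr1 : right_id wr_one wr_mul.
Proof.
move=> [w i]; rewrite /wr_mul /= addr0; congr Wr.
by apply/malgP => k; rewrite mcoeffD mcoeff_shift mcoeff0 addr0.
Qed.

Lemma wr_mulV : left_inverse wr_one wr_inv wr_mul.
Proof. by move=> [w i]; rewrite /wr_mul /= !addNr. Qed.

Lemma wr_mulrV : right_inverse wr_one wr_inv wr_mul.
Proof. by move=> [w i]; rewrite /wr_mul /= shiftN -shiftD !subrr shift0 subrr. Qed.

HB.instance Definition _ :=
  isGroup.Build ZwrZ wr_mulA wr_mul1 wr_mulr1 wr_mulV wr_mulrV.

Definition wr_a : ZwrZ := Wr << 0 >> 0.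
Definition wr_b : ZwrZ := Wr 0 1.

Local Open Scope group_scope.

Lemma wr_bX (n : nat) : wr_b ^+ n = Wr 0%R n%:Z.
Proof.
elim: n => [|n IHn]; first by [].
rewrite expgS IHn; congr Wr.
by apply/malgP => k; rewrite /= mcoeffD mcoeff_shift !mcoeff0 addr0.
Qed.

Lemma wr_conjE (w : {malg int}) (i : int) :
  Wr 0%R i * Wr w 0%R * (Wr 0%R i)^-1 = Wr (shift i w) 0%R.
Proof.
congr Wr; last by rewrite /= addr0 subrr.
apply/malgP => k; rewrite /= !(mcoeffD, mcoeff_shift, mcoeffN, mcoeff0).
by rewrite oppr0 addr0 add0r.
Qed.

Lemma wr_basisE (k : int) :
  Wr 0%R k * wr_a * (Wr 0%R k)^-1 = Wr << k >>%R 0%R.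
Proof. by rewrite wr_conjE shiftU addr0. Qed.

Section Subgroups.
Variable G : groupType.
Implicit Types (S H K : set G) (g x y : G).

Definition is_subgroup H : Prop := group_closed (mem H).

Definition generated S : set G := smallest is_subgroup S.

Definition normal_subgroup H K : Prop :=
  [/\ is_subgroup H, H `<=` K & forall h k, H h -> K k -> H (h ^ k)].

Definition subnormal (r : nat) H : Prop :=
  exists K : nat -> set G,
    [/\ K 0%N = [set: G], K r = H &
        forall i, (i < r)%N -> normal_subgroup (K i.+1) (K i)].

(* [x, y] = x y x^-1 y^-1, unlike the library's [~ x, y] = x^-1 y^-1 x y. *)
Definition comm x y : G := x * y * x^-1 * y^-1.

Definition is_word S (w : seq G) : Prop :=
  forall x, x \in w -> S x \/ S x^-1.

(* The defaults 0 are reached only on sets without minimum (resp. maximum). *)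
Definition min_nat (A : set nat) : nat := xget 0%N (A `&` lbound A).
Definition max_nat (A : set nat) : nat := xget 0%N (A `&` ubound A).

Definition word_length S g : nat :=
  min_nat [set size w | w in [set w | is_word S w /\ \prod_(x <- w) x = g]].

Definition distortion (T H S : set G) (l : nat) : nat :=
  max_nat [set word_length S g | g in [set g | H g /\ (word_length T g <= l)%N]].

End Subgroups.

Definition isomorphic (G G' : groupType) (H : set G) (K : set G') : Prop :=
  exists2 f : G -> G', set_bij H K f & {in H &, {morph f : x y / x * y}}.

Definition preceq (f g : nat -> nat) : Prop :=
  exists2 C : nat, (0 < C)%N & forall l, (f l <= C * g (C * l))%N.

Definition asymp (f g : nat -> nat) : Prop := preceq f g /\ preceq g f.

Definition wr_gens : set ZwrZ := [set wr_a; wr_b].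

(* So word_length wr_gens never takes its default value. *)
Lemma generated_wr_gens : generated wr_gens = [set: ZwrZ].
Proof.
apply/seteqP; split=> // -[w i] _ H [[H1 HF] HS].
have HV := group_closedV (conj H1 HF); have HM := group_closedM (conj H1 HF).
have Ha : wr_a \in H by rewrite inE; apply: HS; left.
have Hb : wr_b \in H by rewrite inE; apply: HS; right.
have HbX n : wr_b ^+ n \in H by elim: n => // n IHn; rewrite expgS HM.
have Hbi j : Wr 0%R j \in H.
  case: j => n; first by rewrite -wr_bX.
  have := HV _ (HbX n.+1); rewrite wr_bX; congr (_ \in H); congr Wr.
  by apply/malgP => k; rewrite mcoeffN mcoeff_shift !mcoeff0 oppr0.
have HD u v : Wr u 0%R \in H -> Wr v 0%R \in H -> Wr (u + v)%R 0%R \in H.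
  move=> Hu /(HM _ _ Hu); congr (_ \in H); congr Wr.
  by rewrite /= shift0.
have HN u : Wr u 0%R \in H -> Wr (- u)%R 0%R \in H.
  move=> /HV; congr (_ \in H); congr Wr.
  by rewrite /= oppr0 shift0.
have Hk k : Wr << k >>%R 0%R \in H by rewrite -wr_basisE !HM ?HV.
have Hn k (n : nat) : Wr << n%:Z *g k >>%R 0%R \in H.
  elim: n => [|n IHn]; first by rewrite monalgU0.
  by rewrite intS monalgUD; apply: HD.
have Hw : Wr w 0%R \in H.
  rewrite [w]monalgE; elim/big_rec: _ => // k v _; apply: HD.
  by case: (w@_k) => n //; rewrite NegzE monalgUN; apply/HN/Hn.
have := HM _ _ Hw (Hbi i); rewrite inE; congr H; congr Wr.
  by apply/malgP => k; rewrite mcoeffD mcoeff_shift mcoeff0 addr0.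
by rewrite /= add0r.
Qed.

Definition wr_comm (m : nat) : ZwrZ := iter m.-1 (fun x => comm x wr_b) wr_a.

Definition wr_H (m : nat) : set ZwrZ := generated [set wr_b; wr_comm m].

(* Main.v *)
Require Import Defs.
From mathcomp Require Import all_boot all_order all_algebra.
From mathcomp Require Import finmap boolp classical_sets functions cardinality.
From mathcomp Require Import monalg zify.

Import Order.TTheory GRing.Theory Num.Theory.

Local Open Scope classical_set_scope.

(* Identify W with Z[X, X^-1], b acting as multiplication by X.  Then [w, b] is
   (1 - X) w for w in W, so (w, i) |-> ((1 - X)^(m-1) w, i) is an injective
   endomorphism with image H_m, and H_(m+1) is normal in H_m because 1 - X
   divides 1 - X^i for every i.

   Up to an additive multiple of l, an element w of W supported in [-l, l] has
   length the l1-norm of w.  For the upper bound on the distortion, w has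
   coefficients bounded by the l1-norm of (1 - X) w, hence l1-norm at most
   2l + 1 times larger.  For the lower bound, (1 - X)^(m-1) maps
   l (1 + X + ... + X^(l-1))^(m-1) to l (1 - X^l)^(m-1), which has length O(l),
   whereas the sum of coefficients of the former is l^m, and that sum is a
   homomorphism to Z, hence Lipschitz for any finite generating set of H_m. *)

(** * Words and generated subgroups *)

Section WordLength.
Local Open Scope group_scope.
Set Implicit Arguments.
Unset Strict Implicit.

Implicit Types G : groupType.

(* Unlike word_length, meaningful for g outside of the subgroup generated by S. *)
Definition reach G (S : set G) (n : nat) (g : G) : Prop :=
  exists2 w, is_word S w & (size w <= n)%N /\ \prod_(x <- w) x = g.

Lemma is_subgroupP G (H : set G) :
  is_subgroup H <-> H 1 /\ forall x y, H x -> H y -> H (x * y^-1).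
Proof.
split=> [[H1 HB]|[H1 HB]].
  split; first exact: set_mem H1.
  by move=> x y /mem_set Hx /mem_set Hy; apply/set_mem/HB.
split; first exact: mem_set.
by move=> x y /set_mem Hx /set_mem Hy; apply/mem_set/HB.
Qed.

Lemma subgroup1 G (H : set G) : is_subgroup H -> H 1.
Proof. by case/is_subgroupP. Qed.

Lemma subgroupV G (H : set G) x : is_subgroup H -> H x -> H x^-1.
Proof. by case/is_subgroupP=> H1 HB Hx; rewrite -[x^-1]mul1g; apply: HB. Qed.

Lemma subgroupM G (H : set G) x y : is_subgroup H -> H x -> H y -> H (x * y).
Proof.
move=> sH Hx Hy; case/is_subgroupP: (sH) => _ HB.
by rewrite -[y]invgK; apply: HB => //; apply: subgroupV.
Qed.

Lemma generated_subgroup G (S : set G) : is_subgroup (generated S).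
Proof.
apply/is_subgroupP; split=> [H [sH _]|x y Sx Sy H [sH SH]].
  exact: subgroup1.
have GH z : generated S z -> H z by move=> Sz; apply: Sz (conj sH SH).
by apply: subgroupM => //; [apply: GH|apply: subgroupV => //; apply: GH].
Qed.

Lemma sub_generated G (S : set G) : S `<=` generated S.
Proof. exact: sub_smallest. Qed.

Lemma generated_sub G (S H : set G) :
  is_subgroup H -> S `<=` H -> generated S `<=` H.
Proof. by move=> sH SH x Sx; apply: Sx (conj sH SH). Qed.

(** A word grows by one letter at its right end; the last premise absorbs the slack between [size w]
    and [n]. *)
Lemma reach_ind G (S : set G) (P : nat -> G -> Prop) :
    P 0%N 1 ->
    (forall n g x, P n g -> S x \/ S x^-1 -> P n.+1 (g * x)) ->
    (forall n g, P n g -> P n.+1 g) ->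
  forall n g, reach S n g -> P n g.
Proof.
move=> P1 PM PS n g [w Sw [lwn <-]]; rewrite -(subnKC lwn) addnC.
elim: (n - size w)%N => [|k IH]; last by rewrite addSn; apply: PS.
rewrite add0n; elim/last_ind: w Sw {lwn} => [|w x IH] Sw; first by rewrite big_nil.
rewrite size_rcons big_rcons; apply: PM.
  by apply: IH => y yw; apply: Sw; rewrite mem_rcons inE yw orbT.
by apply: Sw; rewrite mem_rcons inE eqxx.
Qed.

Lemma reach_mono G (S : set G) n p g : (n <= p)%N -> reach S n g -> reach S p g.
Proof.
by move=> np [w Sw [wn <-]]; exists w => //; split=> //; apply: leq_trans np.
Qed.

Lemma reach1 G (S : set G) n : reach S n 1.
Proof. by exists [::] => //; rewrite big_nil. Qed.

Lemma reach_gen G (S : set G) x : S x \/ S x^-1 -> reach S 1 x.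
Proof.
move=> Sx; exists [:: x]; last by rewrite big_seq1.
by move=> y; rewrite inE => /eqP ->.
Qed.

Lemma reachM G (S : set G) n p g h :
  reach S n g -> reach S p h -> reach S (n + p) (g * h).
Proof.
move=> [v Sv [vn <-]] [w Sw [wp <-]]; exists (v ++ w).
  by move=> x; rewrite mem_cat => /orP[/Sv|/Sw].
by rewrite size_cat big_cat leq_add.
Qed.

Lemma reachV G (S : set G) n g : reach S n g -> reach S n g^-1.
Proof.
elim/reach_ind: n g / => [|n g x IH Sx|n g]; first by rewrite invg1; apply: reach1.
  rewrite invgM -add1n; apply: reachM => //.
  by apply: reach_gen; rewrite invgK; case: Sx; [right|left].
exact: reach_mono.
Qed.

Lemma reachX G (S : set G) n k g : reach S n g -> reach S (k * n) (g ^+ k).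
Proof.
move=> Sg; elim: k => [|k IH]; first by rewrite mul0n expg0; apply: reach1.
by rewrite expgS mulSn; apply: reachM.
Qed.

Lemma reach_trans G (S T : set G) C n g :
    (forall x, T x -> reach S C x) -> reach T n g -> reach S (n * C) g.
Proof.
move=> TS; elim/reach_ind: n g / => [|n g x IH [Tx|Tx]|n g].
- exact: reach1.
- by rewrite mulSn addnC; apply: reachM => //; apply: TS.
- by rewrite mulSn addnC; apply: reachM => //; rewrite -[x]invgK; apply/reachV/TS.
- by apply: reach_mono; rewrite leq_mul2r leqnSn orbT.
Qed.

Lemma generated_reach G (S : set G) g : generated S g -> exists n, reach S n g.
Proof.
move: g; apply: generated_sub => [|x Sx]; last by exists 1%N; apply: reach_gen; left.
apply/is_subgroupP; split=> [|x y [n Sx] [p Sy]]; first by exists 0%N; apply: reach1.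
by exists (n + p)%N; apply/reachM/reachV.
Qed.

(** * Attained extrema and word length *)

Lemma min_natP (A : set nat) n : A n -> A (min_nat A) /\ lbound A (min_nat A).
Proof.
move=> An; have exA : exists n, `[< A n >] by exists n; apply/asboolP.
suff /xgetPex : exists k, (A `&` lbound A) k by apply.
case: (ex_minnP exA) => k /asboolP Ak minA; exists k; split=> // p Ap.
by apply/minA/asboolP.
Qed.

Lemma max_natP (A : set nat) n p :
  A n -> ubound A p -> A (max_nat A) /\ ubound A (max_nat A).
Proof.
move=> An Ap; have exA : exists n, `[< A n >] by exists n; apply/asboolP.
have ubA k : `[< A k >] -> (k <= p)%N by move/asboolP/Ap.
suff /xgetPex : exists k, (A `&` ubound A) k by apply.
case: (ex_maxnP exA ubA) => k /asboolP Ak maxA; exists k; split=> // q Aq.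
by apply/maxA/asboolP.
Qed.

(** When no maximum exists the value is the default 0, which lies below any [p]. *)
Lemma max_nat_le (A : set nat) p : ubound A p -> (max_nat A <= p)%N.
Proof. by rewrite /max_nat => Ap; case: xgetP => // x _ [Ax _]; apply: Ap. Qed.

Lemma word_length_le G (S : set G) n g : reach S n g -> (word_length S g <= n)%N.
Proof.
move=> [w Sw [wn gw]]; apply: leq_trans wn.
have Aw : [set size w | w in [set w | is_word S w /\ \prod_(x <- w) x = g]] (size w).
  by exists w.
by have [_] := min_natP Aw; apply.
Qed.

Lemma reach_word_length G (S : set G) g :
  generated S g -> reach S (word_length S g) g.
Proof.
move=> /generated_reach[n [w Sw [_ gw]]].
have Aw : [set size w | w in [set w | is_word S w /\ \prod_(x <- w) x = g]] (size w).
  by exists w.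
rewrite /word_length; have [[v [Sv gv] <-] _] := min_natP Aw.
by exists v.
Qed.

(** * Images of words and subgroups under homomorphisms *)

Lemma morph1_of_morphM G G' (f : G -> G') : {morph f : x y / x * y} -> f 1 = 1.
Proof. by move=> fM; apply: (mulgI (f 1)); rewrite -fM !mulg1. Qed.

Lemma morphV_of_morphM G G' (f : G -> G') :
  {morph f : x y / x * y} -> {morph f : x / x^-1}.
Proof.
move=> fM x; apply: (mulgI (f x)).
by rewrite -fM !mulgV (morph1_of_morphM fM).
Qed.

Lemma generated_image G G' (f : G -> G') (S : set G) :
  {morph f : x y / x * y} -> generated (f @` S) = f @` generated S.
Proof.
move=> fM.
have f1 := morph1_of_morphM fM; have fV := morphV_of_morphM fM.
have sS := generated_subgroup S.
apply/seteqP; split.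
  apply: generated_sub; last first.
    by move=> _ [x Sx <-]; exists x => //; apply: sub_generated.
  apply/is_subgroupP; split.
    by exists 1 => //; apply: subgroup1 sS.
  move=> _ _ [x Sx <-] [y Sy <-]; exists (x * y^-1); last by rewrite fM fV.
  exact: subgroupM sS Sx (subgroupV sS Sy).
suff sub : generated S `<=` f @^-1` generated (f @` S).
  by move=> _ [x /sub Sx <-].
apply: generated_sub => [|x Sx]; last by apply: sub_generated; exists x.
have sfS := generated_subgroup (f @` S); apply/is_subgroupP; split=> [|x y /= Sx Sy].
  by rewrite /= f1; apply: subgroup1 sfS.
by rewrite fM fV; apply: (subgroupM sfS Sx (subgroupV sfS Sy)).
Qed.

Lemma reach_image G G' (f : G -> G') (S : set G) n g :
  {morph f : x y / x * y} -> reach S n g -> reach (f @` S) n (f g).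
Proof.
move=> fM.
have f1 := morph1_of_morphM fM; have fV := morphV_of_morphM fM.
elim/reach_ind: n g / => [|n g x IH Sx|n g]; last exact: reach_mono.
  by rewrite f1; apply: reach1.
rewrite fM -addn1; apply: reachM => //; apply: reach_gen.
by case: Sx => Sx; [left; exists x|right; exists x^-1].
Qed.

Lemma finite_reach G (S T : set G) : finite_set T -> T `<=` generated S ->
  exists C, forall x, T x -> reach S C x.
Proof.
move=> /finite_seqP[s ->] sS.
exists (\max_(x <- s) word_length S x) => x /= xs.
by apply: reach_mono (reach_word_length (sS _ xs)); apply: leq_bigmax_seq.
Qed.

Lemma preceq_expn (f : nat -> nat) C m :
  (forall l, (f l <= C * l ^ m)%N) -> preceq f (fun l => l ^ m)%N.
Proof.
(* The successor keeps the constant positive, and rescaling [l] by it only increases the power. *)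
move=> fC; exists C.+1 => // l; apply: leq_trans (fC l) _.
by apply: leq_mul => //; case: m {fC} => // m; rewrite leq_exp2r // leq_pmull.
Qed.
End WordLength.

(** * Laurent polynomials *)

(** The innermost [f] and [g] merge into [h], which then moves out past the remaining copies of [f].
    This will give (1 - X)^p (1 + ... + X^(n-1))^p = (1 - X^n)^p. *)
Lemma iter_comm_comp (T : Type) (f g h : T -> T) (p : nat) :
  (forall x, f (g x) = h x) -> (forall x, f (h x) = h (f x)) ->
  forall x, iter p f (iter p g x) = iter p h x.
Proof.
move=> fg fh x; elim: p => // p IH; rewrite iterSr iterS fg iterS -IH.
by elim: {IH}p (iter p g x) => // p IH y; rewrite !iterS IH fh.
Qed.

(* Multiplication by 1 - X^i. *)
Definition diff_by (i : int) (w : {malg int}) : {malg int} := (w - shift i w)%R.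
Local Notation diff := (diff_by 1%R).

Section LaurentPolynomials.
Local Open Scope ring_scope.
Set Implicit Arguments.
Unset Strict Implicit.

Implicit Types (u v w : {malg int}) (i j k : int).

(* Multiplication by 1 + X + ... + X^(n-1). *)
Definition geom (n : nat) w := \sum_(j < n) shift j%:Z w.

Lemma diff_byE i w k : (diff_by i w)@_k = w@_k - w@_(k - i).
Proof. by rewrite !(mcoeff_shift, mcoeffsE). Qed.

Lemma diff_byD i : {morph diff_by i : u v / u + v}.
Proof. by move=> u v; rewrite /diff_by shift_is_additive opprD addrACA. Qed.

Lemma diff_byN i : {morph diff_by i : u / - u}.
Proof. by move=> u; rewrite /diff_by shiftN opprD. Qed.

Lemma diff_by_shift i j w : diff_by i (shift j w) = shift j (diff_by i w).
Proof. by rewrite /diff_by shift_is_additive shiftN -!shiftD (addrC i). Qed.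

Lemma diff_byC i j w : diff_by i (diff_by j w) = diff_by j (diff_by i w).
Proof. by rewrite {2}/diff_by diff_byD diff_byN diff_by_shift. Qed.

(** The geometric sum telescopes. *)
Lemma diff_geom n w : diff (geom n w) = diff_by n%:Z w.
Proof.
rewrite /geom; elim: n => [|n IH].
  by rewrite big_ord0 /diff_by shift0 subrr; apply/malgP=> k;
     rewrite !(mcoeff_shift, mcoeffsE) subrr.
rewrite big_ord_recr /= diff_byD IH /diff_by -shiftD addrA subrK.
by rewrite intS; reflexivity.
Qed.

Lemma iter_diff_geom n p w :
  iter p diff (iter p (geom n) w) = iter p (diff_by n%:Z) w.
Proof. by apply: iter_comm_comp => v; [apply: diff_geom|apply: diff_byC]. Qed.

(** * The l1-norm *)

Definition l1norm w : nat := (\sum_(k <- msupp w) `|w@_k|)%N.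

(** Coefficients off [msupp w] vanish and [s] counts none twice. Norms can thus be compared along
    the support of another polynomial or a translate. *)
Lemma l1norm_ge w (s : seq int) :
  uniq s -> (\sum_(k <- s) `|w@_k| <= l1norm w)%N.
Proof.
move=> us; rewrite (bigID (mem (msupp w))) /= addnC big1; last first.
  by move=> k /mcoeff_outdom ->.
rewrite add0n /l1norm [leqRHS](bigID (mem s)) /= -big_filter -[in leqRHS]big_filter.
apply: leq_trans (leq_addr _ _); rewrite (perm_big [seq k <- msupp w | k \in s]) //.
by apply: uniq_perm; rewrite ?filter_uniq ?fset_uniq // => k; rewrite !mem_filter andbC.
Qed.

Lemma l1normD u v : (l1norm (u + v) <= l1norm u + l1norm v)%N.
Proof.
have us := fset_uniq (msupp (u + v)).
apply: leq_trans (leq_add (l1norm_ge u us) (l1norm_ge v us)).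
rewrite -big_split /=; apply: leq_sum => k _.
by rewrite mcoeffD -lez_nat PoszD !abszE ler_normD.
Qed.

Lemma l1normN u : l1norm (- u) = l1norm u.
Proof. by rewrite /l1norm msuppN; apply: eq_bigr => k _; rewrite mcoeffN abszN. Qed.

Lemma l1norm_shift i u : (l1norm (shift i u) <= l1norm u)%N.
Proof.
rewrite /l1norm; under eq_bigr do rewrite mcoeff_shift.
rewrite -(big_map (fun k => k - i) xpredT (fun k => `|u@_k|%N)).
by apply: l1norm_ge; rewrite map_inj_uniq ?fset_uniq //; apply: addIr.
Qed.

Lemma l1normU c k : (l1norm << c *g k >> <= `|c|)%N.
Proof.
rewrite /l1norm msuppU; case: eqP => [->|_]; first by rewrite big_seq_fset0.
by rewrite big_seq_fset1 mcoeffUU.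
Qed.

Lemma l1norm_diff_by i w : (l1norm (diff_by i w) <= 2 * l1norm w)%N.
Proof.
by rewrite mul2n -addnn (leq_trans (l1normD _ _)) // leq_add2l l1normN l1norm_shift.
Qed.

(** * Windows of support and division by 1 - X *)

Definition supported (N : nat) w := forall k, (N < `|k|)%N -> w@_k = 0.

Lemma supported_mono N M w : (N <= M)%N -> supported N w -> supported M w.
Proof. by move=> NM Nw k kM; apply: Nw; apply: leq_ltn_trans kM. Qed.

Lemma supportedD N u v : supported N u -> supported N v -> supported N (u + v).
Proof. by move=> uN vN k kN; rewrite mcoeffD uN ?vN. Qed.

Lemma supportedN N u : supported N u -> supported N (- u).
Proof. by move=> uN k kN; rewrite mcoeffN uN ?oppr0. Qed.

Lemma supported_shift N i u : supported N u -> supported (N + `|i|) (shift i u).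
Proof. by move=> uN k kN; rewrite mcoeff_shift uN //; lia. Qed.

Lemma supportedU c k : supported `|k| << c *g k >>.
Proof.
by move=> j jk; rewrite mcoeffU; case: eqP => // kj; move: jk; rewrite kj ltnn.
Qed.

Lemma supported_diff_by N i w : supported N w -> supported (N + `|i|) (diff_by i w).
Proof.
move=> wN; apply: supportedD; last exact/supportedN/supported_shift.
by apply: supported_mono wN; rewrite leq_addr.
Qed.

Lemma supported_ex w : exists N, supported N w.
Proof.
exists (\max_(k <- msupp w) `|k|)%N => k; case: msuppP => // kw.
rewrite ltnNge => /negP[].
exact: (@leq_bigmax_seq _ _ xpredT (fun j : int => `|j|%N)).
Qed.

(** The coefficients are constant along the ray from [k] down to minus infinity, and finite support
    makes them vanish far out. *)
Lemma mcoeff_eq0_below w k : (forall j, j <= k -> w@_j = w@_(j - 1)) -> w@_k = 0.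
Proof.
move=> wk; have [N wN] := supported_ex w.
have step n : w@_k = w@_(k - n%:Z).
  elim: n => [|n ->]; first by rewrite subr0.
  rewrite wk; last by lia.
  by congr (_@_ _); lia.
by rewrite (step (N + `|k| + 1)%N) wN //; lia.
Qed.

Lemma mcoeff_eq0_above w k : (forall j, k < j -> w@_j = w@_(j - 1)) -> w@_k = 0.
Proof.
move=> wk; have [N wN] := supported_ex w.
have step n : w@_k = w@_(k + n%:Z).
  elim: n => [|n ->]; first by rewrite addr0.
  rewrite [RHS]wk; last by lia.
  by congr (_@_ _); lia.
by rewrite (step (N + `|k| + 1)%N) wN //; lia.
Qed.

(** Outside the window [w] is constant along each of two rays, hence zero: dividing by 1 - X does
    not widen the support. *)
Lemma supported_diff N w : supported N (diff w) -> supported N w.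
Proof.
move=> dN k kN.
have dE j : (N < `|j|)%N -> w@_j = w@_(j - 1).
  by move=> /dN /eqP; rewrite diff_byE subr_eq0 => /eqP.
case: (lerP k 0) => k0; [apply: mcoeff_eq0_below|apply: mcoeff_eq0_above].
  by move=> j jk; apply: dE; lia.
by move=> j jk; apply: dE; lia.
Qed.

Lemma diff_inj : injective diff.
Proof.
move=> u v uv; apply/eqP; rewrite -subr_eq0; apply/eqP/malgP => k; rewrite mcoeff0.
apply: mcoeff_eq0_below => j _; apply/eqP; rewrite -subr_eq0 -diff_byE.
by rewrite diff_byD diff_byN uv subrr mcoeff0.
Qed.

(** The coefficient at [k] telescopes into the coefficients of (1 - X) w at k, k - 1, and so on,
    down to a place below the support. *)
Lemma mcoeff_le_l1norm_diff w k : (`|w@_k| <= l1norm (diff w))%N.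
Proof.
have [N wN] := supported_ex w.
(* N + |k| + 1 steps down from [k] lead below -N. *)
pose s := [seq k - j%:Z | j : nat <- iota 0 (N + `|k| + 1)].
have us : uniq s by rewrite map_inj_uniq ?iota_uniq // => x y; lia.
apply: leq_trans (l1norm_ge (diff w) us); rewrite big_map.
have step n : (`|w@_k| <= \sum_(j <- iota 0 n) `|(diff w)@_(k - j%:Z)%R| +
                          `|w@_(k - n%:Z)%R|)%N.
  elim: n => [|n IH]; first by rewrite subr0 leq_addl.
  rewrite -addn1 iotaD big_cat big_seq1.
  rewrite diff_byE; have -> : k - (n + 1)%N%:Z = k - n%:Z - 1 by lia.
  rewrite /= add0n; apply: leq_trans IH _; rewrite -addnA leq_add2l.
  rewrite -lez_nat PoszD !abszE -[X in `|X| <= _](subrK w@_(k - n%:Z - 1)).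
  exact: ler_normD.
have w0 : w@_(k - (N + `|k| + 1)%N%:Z) = 0 by apply: wN; lia.
by have := step (N + `|k| + 1)%N; rewrite w0 absz0 addn0.
Qed.

(** At most 2N + 1 coefficients are nonzero, each bounded by the norm of (1 - X) w. *)
Lemma l1norm_le_diff N w : supported N (diff w) ->
  (l1norm w <= (2 * N + 1) * l1norm (diff w))%N.
Proof.
move=> /supported_diff wN; rewrite /l1norm.
apply: leq_trans (_ : \sum_(k <- msupp w) l1norm (diff w) <= _)%N.
  by apply: leq_sum => k _; apply: mcoeff_le_l1norm_diff.
rewrite big_const_seq count_predT iter_addn_0 mulnC leq_mul2r.
apply/orP; right.
pose s := [seq j%:Z - N%:Z | j : nat <- iota 0 (2 * N + 1)].
rewrite -[X in (_ <= X)%N](size_iota 0) -(size_map (fun j : nat => j%:Z - N%:Z)).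
apply: uniq_leq_size => // k; rewrite -mcoeff_neq0 => wk.
have kN : (`|k| <= N)%N by rewrite leqNgt; apply: contra_neqN wk => /wN.
by apply/mapP; exists `|(k + N%:Z)%R|%N; [rewrite mem_iota; lia|lia].
Qed.

(** The window stays the same, so one factor 2N + 1 serves for each of the [p] divisions by 1 -
    X. *)
Lemma l1norm_le_iter_diff N p w : supported N (iter p diff w) ->
  supported N w /\ (l1norm w <= (2 * N + 1) ^ p * l1norm (iter p diff w))%N.
Proof.
elim: p w => [|p IH] w; first by rewrite mul1n.
rewrite iterSr => /IH[dN le]; split; first exact: supported_diff.
apply: leq_trans (l1norm_le_diff dN) _.
by rewrite expnS -mulnA leq_mul2l le orbT.
Qed.

(** Evaluation at X = 1, that is, the sum of the coefficients. *)
Definition augmentation w : int := mmap idfun (fun=> 1) w.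

Lemma augmentationD : {morph augmentation : u v / u + v}.
Proof. exact: mmapD. Qed.

Lemma augmentationN : {morph augmentation : u / - u}.
Proof. exact: mmapN. Qed.

Lemma augmentationU c k : augmentation << c *g k >> = c.
Proof. by rewrite /augmentation mmapU mulr1. Qed.

Lemma augmentation_shift i w : augmentation (shift i w) = augmentation w.
Proof.
rewrite /augmentation /shift raddf_sum /= [RHS]mmapE.
by apply: eq_bigr => k _; rewrite mmapU.
Qed.

Lemma augmentation_geom n w : augmentation (geom n w) = n%:Z * augmentation w.
Proof.
rewrite /geom {1}/augmentation raddf_sum /=.
under eq_bigr do rewrite -[mmap _ _ _]/(augmentation _) augmentation_shift.
by rewrite sumr_const card_ord -mulr_natl natz.
Qed.

Lemma augmentation_iter_geom n p w :
  augmentation (iter p (geom n) w) = (n ^ p)%:Z * augmentation w.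
Proof.
elim: p => [|p IH]; first by rewrite mul1r.
by rewrite iterS augmentation_geom IH mulrA expnS PoszM.
Qed.
End LaurentPolynomials.

(** * The subgroups H_m *)

Section DiffHom.
Local Open Scope ring_scope.
Set Implicit Arguments.
Unset Strict Implicit.

Implicit Types (u v w : {malg int}) (i j k : int) (g h : ZwrZ) (p : nat).

Lemma wr_mulE u i v j : (Wr u i * Wr v j)%g = Wr (u + shift i v) (i + j).
Proof. exact: erefl. Qed.

Lemma wr_invE u i : ((Wr u i)^-1)%g = Wr (- shift (- i) u) (- i).
Proof. exact: erefl. Qed.

Lemma shift_zero i : shift i 0 = 0.
Proof. by apply/malgP => k; rewrite !(mcoeff_shift, mcoeffsE). Qed.

(** Multiplication by (1 - X)^p on W, extended by the identity on powers of b; [p] is m - 1 from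
    here on. *)
Definition diff_hom p g : ZwrZ := Wr (iter p diff (passive g)) (active g).

Lemma iter_diffD p : {morph iter p diff : u v / u + v}.
Proof.
elim: p => [|p IH] u v; first exact: erefl.
rewrite !iterS IH; exact: diff_byD.
Qed.

Lemma iter_diff_shift p i w : iter p diff (shift i w) = shift i (iter p diff w).
Proof.
elim: p => [|p IH]; first exact: erefl.
rewrite !iterS IH; exact: diff_by_shift.
Qed.

Lemma diff_homM p : {morph diff_hom p : g h / (g * h)%g}.
Proof.
case=> [u i] [v j]; rewrite wr_mulE /diff_hom /= iter_diffD iter_diff_shift.
exact: erefl.
Qed.

Lemma diff_hom_inj p : injective (diff_hom p).
Proof.
case=> [u i] [v j] [uv ->]; congr Wr.
elim: p uv => [|p IH] uv; first exact: uv.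
exact: IH (diff_inj uv).
Qed.

Lemma diff_homD p q g : diff_hom (p + q) g = diff_hom p (diff_hom q g).
Proof. by rewrite /diff_hom iterD. Qed.

Lemma comm_wr_b w : comm (Wr w 0) wr_b = Wr (diff w) 0.
Proof.
rewrite /comm !(wr_mulE, wr_invE) !(add0r, addr0, oppr0, shift_zero) shift0 subrr.
by rewrite shiftN.
Qed.

Lemma wr_commE p : wr_comm p.+1 = diff_hom p wr_a.
Proof.
rewrite /wr_comm /=; elim: p => [|p IH]; first exact: erefl.
by rewrite !iterS IH comm_wr_b.
Qed.

Lemma diff_hom_b p : diff_hom p wr_b = wr_b.
Proof.
congr Wr; elim: p => [|p IH]; first exact: erefl.
rewrite iterS {}IH /diff_by shift_zero.
exact: subrr.
Qed.

Lemma image_wr_gens p : diff_hom p @` wr_gens = [set wr_b; wr_comm p.+1].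
Proof. by rewrite image_setU !image_set1 diff_hom_b wr_commE setUC. Qed.

(** A homomorphism carries generated subgroups to generated subgroups, and [wr_gens] generates the
    whole group. *)
Lemma wr_HE p : wr_H p.+1 = range (diff_hom p).
Proof.
rewrite /wr_H -image_wr_gens generated_image ?generated_wr_gens //.
exact: diff_homM.
Qed.

Lemma diff_by_diff i v : exists u, diff_by i v = diff u.
Proof.
case: i => n; first by exists (geom n v); rewrite diff_geom.
(* For negative exponents, 1 - X^(-n) = - X^(-n) (1 - X^n), applied to n + 1 because [Negz n] is -(n
   + 1). *)
exists (- shift (- n.+1%:Z) (geom n.+1 v)); rewrite diff_byN diff_by_shift diff_geom.
by rewrite NegzE /diff_by shift_is_additive shiftN -shiftD addNr shift0 opprB.
Qed.

(** For g = (w, i) and h = (v, j), the conjugate has passive part X^(-j) ((1 - X) w - (1 - X^i) v),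
    and 1 - X divides both terms. *)
Lemma conj_diff_hom g h : exists g', (diff_hom 1 g ^ h)%g = diff_hom 1 g'.
Proof.
case: g h => [w i] [v j]; have [u uE] := diff_by_diff i v.
exists (Wr (shift (- j) (w - u)) i).
rewrite conjgE /diff_hom /= !(wr_mulE, wr_invE) diff_by_shift diff_byD diff_byN -uE.
congr Wr; last by rewrite addrCA addNr addr0.
rewrite /diff_by !(shift_is_additive, shiftN) opprB -!shiftD /=.
by rewrite addrC -addrA.
Qed.

(** The pair is the image under [diff_hom p] of H_2 inside the whole group, where [conj_diff_hom]
    gives normality. *)
Lemma normal_wr_H p : normal_subgroup (wr_H p.+2) (wr_H p.+1).
Proof.
have homS g : diff_hom p.+1 g = diff_hom p (diff_hom 1 g).
  by rewrite -diff_homD addn1.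
split; first exact: generated_subgroup.
  by rewrite !wr_HE => _ [g _ <-]; rewrite homS; exists (diff_hom 1 g).
rewrite !wr_HE => _ _ [g _ <-] [h _ <-]; have [g' g'E] := conj_diff_hom g h.
exists g'; first exact: I.
rewrite !homS -g'E !conjgE !diff_homM.
by rewrite (morphV_of_morphM (@diff_homM p)).
Qed.

Lemma wr_H1 : wr_H 1 = [set: ZwrZ].
Proof. by rewrite -generated_wr_gens /wr_gens setUC. Qed.

Lemma subnormal_wr_H p : subnormal p (wr_H p.+1).
Proof.
exists (fun q : nat => wr_H q.+1); split=> // [|q _]; first exact: wr_H1.
exact: normal_wr_H.
Qed.

(** A left inverse of [diff_hom p], with the default value 1 off the image. *)
Definition diff_hom_inv p (x : ZwrZ) : ZwrZ := xget 1%g [set g | diff_hom p g = x].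

Lemma diff_homK p : cancel (diff_hom p) (diff_hom_inv p).
Proof.
by move=> g; apply: xget_unique => // h /= /diff_hom_inj.
Qed.

Lemma isomorphic_wr_H p : isomorphic (wr_H p.+1) [set: ZwrZ].
Proof.
rewrite wr_HE; exists (diff_hom_inv p).
  split=> // [x y|g _].
    by rewrite !inE => -[g _ <-] [h _ <-]; rewrite !diff_homK => ->.
  by exists (diff_hom p g); [exists g|apply: diff_homK].
move=> x y; rewrite !inE => -[g _ <-] [h _ <-].
by rewrite -diff_homM !diff_homK.
Qed.
End DiffHom.

(** * Distortion *)

Section WordMetric.
Local Open Scope ring_scope.
Set Implicit Arguments.
Unset Strict Implicit.

Implicit Types (u v w : {malg int}) (i j k : int) (g h : ZwrZ) (n p l N : nat).

Lemma wr_gens_sym g : wr_gens g \/ wr_gens g^-1%g ->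
  exists2 c, (`|c| <= 1)%N & g = Wr << c *g 0 >> 0 \/ g = Wr 0 c.
Proof.
case=> -[] gE; first by exists 1; rewrite ?gE //; left.
- by exists 1; rewrite ?gE //; right.
- exists (-1) => //; left; rewrite -[g]invgK gE wr_invE oppr0 shift0.
  by rewrite monalgUN.
- exists (-1) => //; right; rewrite -[g]invgK gE wr_invE shift_zero.
  by rewrite oppr0.
Qed.

(** A letter a or a^-1 appended to (w, i) changes [w] only at position [i], where |i| is at most the
    number of letters so far; a letter b or b^-1 moves [i] by one. *)
Lemma reach_wr_gens_bound n g : reach wr_gens n g ->
  [/\ supported n (passive g), (l1norm (passive g) <= n)%N & (`|active g| <= n)%N].
Proof.
elim/reach_ind: n g /.
- rewrite -[1%g]/(Wr 0 0) /=; split=> // [k _|]; first exact: mcoeff0.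
  by rewrite /l1norm msupp0 big_seq_fset0.
- move=> n [w i] x [/= wn w1 iN] /wr_gens_sym[c c1 [->|->]] /=.
    rewrite shiftU !addr0; split; last exact: leqW.
      apply: supportedD; first exact: supported_mono wn.
      by apply: supported_mono (@supportedU _ _); apply: leqW.
    apply: leq_trans (l1normD _ _) _; rewrite -addn1 leq_add //.
    exact: leq_trans (l1normU _ _) _.
  rewrite shift_zero addr0; split; [exact: supported_mono wn|exact: leqW|lia].
- move=> n g [wn w1 iN]; split; [exact: supported_mono wn|exact: leqW|exact: leqW].
Qed.

Lemma reach_wr_a c : reach wr_gens `|c| (Wr << c *g 0 >> 0).
Proof.
have pos n : reach wr_gens n (Wr << n%:Z *g 0 >> 0).
  elim: n => [|n IH]; first by rewrite monalgU0; apply: reach1.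
  have -> : Wr << n.+1%:Z *g 0 >> 0 = (wr_a * Wr << n%:Z *g 0 >> 0)%g.
    by rewrite wr_mulE shift0 -monalgUD intS.
  rewrite -add1n; apply: reachM IH; apply: reach_gen; left; left; exact: erefl.
case: c => n; first exact: pos.
have -> : Wr << Negz n *g 0 >> 0 = ((Wr << n.+1%:Z *g 0 >> 0)^-1)%g.
  by rewrite wr_invE oppr0 shift0 NegzE monalgUN.
exact: reachV.
Qed.

Lemma reach_wr_b i : reach wr_gens `|i| (Wr 0 i).
Proof.
have pos n : reach wr_gens n (Wr 0 n%:Z).
  by rewrite -wr_bX -[X in reach _ X]muln1; apply/reachX/reach_gen; left; right.
case: i => n; first exact: pos.
have -> : Wr 0 (Negz n) = ((Wr 0 n.+1%:Z)^-1)%g.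
  by rewrite wr_invE shift_zero oppr0 NegzE.
exact: reachV.
Qed.

(* The word is a^(c 0) b a^(c 1) b ... b a^(c n). *)
Lemma reach_sweep (c : nat -> int) n :
  reach wr_gens (\sum_(j < n.+1) `|c j| + n)
    (Wr (\sum_(j < n.+1) << c j *g j%:Z >>) n%:Z).
Proof.
elim: n => [|n IH]; first by rewrite !big_ord1 addn0; apply: reach_wr_a.
have := reachM IH (reachM (reach_wr_b 1) (reach_wr_a (c n.+1))).
rewrite !wr_mulE add0r !shiftU !addr0 /= => sweep.
have nE : n.+1%:Z = n%:Z + 1 by lia.
rewrite !(big_ord_recr n.+1) /= nE; apply: reach_mono sweep; lia.
Qed.

Lemma malg_nat_window v n :
    (forall k, ~~ (0 <= k < n%:Z) -> v@_k = 0) ->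
  v = \sum_(j < n) << v@_(j%:Z) *g j%:Z >>.
Proof.
move=> v0; apply/malgP => k; rewrite raddf_sum /=.
under eq_bigr do rewrite mcoeffU.
have [/andP[k0 kn]|kn] := boolP (0 <= k < n%:Z); last first.
  rewrite v0 // big1 // => j _; case: eqP => // jk; case/negP: kn.
  by rewrite -jk ltz_nat ltn_ord.
have kn' : (`|k| < n)%N by lia.
have kE : (`|k|%N)%:Z = k by lia.
rewrite (bigD1 (Ordinal kn')) //= kE eqxx big1 ?addr0 // => j /eqP jk.
case: eqP => // jE; case: jk; apply: val_inj => /=; lia.
Qed.

(** Move to -N, sweep up to N, then move to [i]: the costs are N, the norm plus 2N, and |i - N|. *)
Lemma reach_wr_gens N w i : supported N w ->
  reach wr_gens (l1norm w + 4 * N + `|i|) (Wr w i).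
Proof.
move=> wN; pose v := shift N%:Z w.
have vE : v = \sum_(j < (2 * N).+1) << v@_(j%:Z) *g j%:Z >>.
  by apply: malg_nat_window => k kN; rewrite mcoeff_shift wN //; lia.
have vl : (\sum_(j < (2 * N).+1) `|v@_j%:Z| <= l1norm w)%N.
  rewrite -(big_mkord xpredT (fun j : nat => `|v@_(j%:Z)%R|%N)).
  under eq_bigr do rewrite mcoeff_shift.
  rewrite -(big_map (fun j : nat => (j%:Z - N%:Z)%R) xpredT (fun k => `|w@_k|%N)).
  by apply: l1norm_ge; rewrite map_inj_uniq ?iota_uniq // => x y; lia.
have sweep := reach_sweep (fun j : nat => v@_(j%:Z)) (2 * N).
have := reachM (reachM (reach_wr_b (- N%:Z)) sweep) (reach_wr_b (i - N%:Z)).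
rewrite -vE !wr_mulE !shift_zero add0r addr0 -shiftD addNr shift0.
have -> : - N%:Z + (2 * N)%N%:Z + (i - N%:Z) = i by lia.
by apply: reach_mono; lia.
Qed.

(** The preimage under [diff_hom p] has support in [-l, l] and norm at most (2l + 1)^p l; a word for
    it is carried letter by letter to a word for [h]. *)
Lemma reach_wr_H p l h : wr_H p.+1 h -> reach wr_gens l h ->
  reach [set wr_b; wr_comm p.+1] ((3 ^ p + 5) * l ^ p.+1) h.
Proof.
rewrite wr_HE => -[[w i] _ <-] /reach_wr_gens_bound[/= dl dn il].
have [wl wn] := l1norm_le_iter_diff dl; rewrite -image_wr_gens.
apply/(reach_image (@diff_homM p))/(reach_mono _ (reach_wr_gens i wl)).
(* The case l = 0 is separate because 2l + 1 <= 3l, the source of 3^p, requires l >= 1. The 5l below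
   is 4l for the window plus l for the active part. *)
case: l {dl wl} dn il wn => [|l] dn il wn; first by move: dn wn; nia.
apply: leq_trans (_ : (2 * l.+1 + 1) ^ p * l.+1 + 5 * l.+1 <= _)%N.
  have : ((2 * l.+1 + 1) ^ p * l1norm (iter p diff w) <= (2 * l.+1 + 1) ^ p * l.+1)%N.
    by rewrite leq_mul2l dn orbT.
  lia.
rewrite mulnDl expnSr mulnA -expnMn leq_add // leq_mul //.
  by case: p {dn wn} => // p; rewrite leq_exp2r //; lia.
by rewrite leq_pmull // expn_gt0.
Qed.

(** Augmentation after the inverse of [diff_hom p] is a homomorphism from the subgroup to Z; [C]
    bounds it on [S], hence it changes by at most [C] per letter. *)
Lemma augmentation_le p (S : set ZwrZ) : finite_set S -> S `<=` wr_H p.+1 ->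
  exists C, forall n g, reach S n (diff_hom p g) ->
    (`|augmentation (passive g)| <= C * n)%N.
Proof.
rewrite wr_HE => /finite_seqP[s ->] sH.
pose aug g := augmentation (passive g).
exists (\max_(x <- s) `|aug (diff_hom_inv p x)|)%N => n g.
set C := (\max_(x <- s) _)%N.
have augM : {morph aug : x y / (x * y)%g >-> x + y}.
  by move=> [u i] [v j]; rewrite /aug /= augmentationD augmentation_shift.
have augV x : aug (x^-1)%g = - aug x.
  by case: x => u i; rewrite /aug /= augmentationN augmentation_shift.
have leC y : diff_hom p y \in s -> (`|aug y| <= C)%N.
  move=> ys; rewrite -{1}(diff_homK p y).
  exact: (@leq_bigmax_seq _ _ xpredT (fun x => `|aug (diff_hom_inv p x)|%N)).
(* Everything reached from [S] lies in the image, so a preimage is carried along the induction on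
   words. *)
suff: forall n x, reach [set` s] n x ->
    exists2 y, diff_hom p y = x & (`|aug y| <= C * n)%N.
  by move=> sub /sub[y /diff_hom_inj ->].
move=> {g} {}n x; elim/reach_ind: n x /.
- exists 1%g; first exact: morph1_of_morphM (@diff_homM p).
  by rewrite /aug /= /augmentation mmap0.
- move=> n _ x [y <- yn] xs.
  have [z zx zC] : exists2 z, diff_hom p z = x & (`|aug z| <= C)%N.
    case: xs => /[dup] /sH[z _ zx]; rewrite /= -zx => /leC zC; first by exists z.
    exists z^-1%g; last by rewrite augV abszN.
    by rewrite (morphV_of_morphM (@diff_homM p)) zx invgK.
  exists (y * z)%g; first by rewrite diff_homM zx.
  by rewrite augM mulnS; lia.
- by move=> n _ [y <- yn]; exists y => //; apply: leq_trans yn _;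
  rewrite leq_mul2l leqnSn orbT.
Qed.

Lemma l1norm_iter_diff_by l p w :
  (l1norm (iter p (diff_by l%:Z) w) <= 2 ^ p * l1norm w)%N.
Proof.
elim: p => [|p IH]; first by rewrite mul1n.
rewrite iterS expnS -mulnA; apply: leq_trans (l1norm_diff_by _ _) _.
by rewrite leq_mul2l IH orbT.
Qed.

Lemma supported_iter_diff_by l p w N : supported N w ->
  supported (N + p * l) (iter p (diff_by l%:Z) w).
Proof.
move=> wN; elim: p => [|p IH]; first by rewrite addn0.
rewrite iterS mulSnr addnA; exact: (@supported_diff_by _ l%:Z _ IH).
Qed.

Lemma long_element p l : exists g,
  reach wr_gens ((2 ^ p + 4 * p) * l) (diff_hom p g) /\
  augmentation (passive g) = (l ^ p.+1)%:Z.
Proof.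
pose w : {malg int} := << l%:Z *g 0 >>.
exists (Wr (iter p (geom l) w) 0); split; last first.
  by rewrite augmentation_iter_geom augmentationU -PoszM expnSr.
rewrite /diff_hom /= iter_diff_geom.
have w0 : supported 0 w by exact: (@supportedU l%:Z 0).
(* The norm is at most 2^p l and the window is p l, hence the constant 2^p + 4p. *)
apply: reach_mono (reach_wr_gens 0 (@supported_iter_diff_by l p _ _ w0)).
rewrite add0n addn0 mulnDl mulnA leq_add2r.
apply: leq_trans (l1norm_iter_diff_by _ _ _) _; rewrite leq_mul2l.
by rewrite (leq_trans (l1normU _ _)) ?orbT.
Qed.

Lemma distortion_wr_H p (S : set ZwrZ) :
    finite_set S -> generated S = wr_H p.+1 ->
  asymp (distortion wr_gens (wr_H p.+1) S) (fun l : nat => l ^ p.+1)%N.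
Proof.
move=> finS genS.
have finT : finite_set [set wr_b; wr_comm p.+1] by [].
(* Passing from the standard pair of generators to [S] costs a constant factor. *)
have [C TC] : exists C, forall x, [set wr_b; wr_comm p.+1] x -> reach S C x.
  by apply: finite_reach => //; rewrite genS; apply: sub_generated.
have upper l h : wr_H p.+1 h -> (word_length wr_gens h <= l)%N ->
    (word_length S h <= (3 ^ p + 5) * C * l ^ p.+1)%N.
  move=> Hh hl; apply: word_length_le; rewrite mulnAC; apply: reach_trans TC _.
  apply: reach_wr_H => //; apply: reach_mono hl _; apply: reach_word_length.
  by rewrite generated_wr_gens.
split.
  apply: preceq_expn => l; apply: max_nat_le => _ [h [Hh hl] <-].
  exact: upper Hh hl.
have SH : S `<=` wr_H p.+1 by rewrite -genS; apply: sub_generated.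
have [D augD] := augmentation_le finS SH.
(* One constant serves twice: as outer factor it must be at least [D], and as rescaling of [l] at
   least 2^p + 4p, from [long_element]. *)
exists (2 ^ p + 4 * p + D)%N; first by rewrite -addnA ltn_addr // expn_gt0.
move=> l; set E := (2 ^ p + _ + D)%N.
have [g [gl gE]] := long_element p l.
have Hg : wr_H p.+1 (diff_hom p g) by rewrite wr_HE; exists g.
have gS : (l ^ p.+1 <= D * word_length S (diff_hom p g))%N.
  rewrite -[X in (X <= _)%N]/(`|(l ^ p.+1)%:Z|%N) -gE; apply: augD.
  by apply: reach_word_length; rewrite genS.
apply: leq_trans gS _; apply: leq_mul; first exact: leq_addl.
rewrite /distortion; set A := [set _ | _ in _].
have Ag : A (word_length S (diff_hom p g)).
  exists (diff_hom p g) => //; split=> //; apply: word_length_le.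
  by apply: reach_mono gl; rewrite leq_mul2r leq_addr orbT.
(* The upper estimate bounds [A], so the maximum is attained and is not the default. *)
have ubA : ubound A ((3 ^ p + 5) * C * (E * l) ^ p.+1)%N.
  by move=> _ [h [Hh hl] <-]; apply: upper.
have [_] := max_natP Ag ubA; exact.
Qed.
End WordMetric.

Theorem corollary1p4 :
  (forall m : nat, (1 <= m)%N ->
    [/\ subnormal m.-1 (wr_H m),
        isomorphic (wr_H m) [set: ZwrZ] &
        forall S : set ZwrZ, finite_set S -> generated S = wr_H m ->
          asymp (distortion wr_gens (wr_H m) S) (fun l : nat => (l ^ m)%N)]) /\
  [/\ normal_subgroup (generated [set wr_b; comm wr_a wr_b]) [set: ZwrZ] &
      forall S : set ZwrZ, finite_set S ->
        generated S = generated [set wr_b; comm wr_a wr_b] ->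
        asymp (distortion wr_gens (generated [set wr_b; comm wr_a wr_b]) S)
          (fun l : nat => (l ^ 2)%N)].
Proof.
split.
  case=> // p _; split; [exact: subnormal_wr_H|exact: isomorphic_wr_H|].
  exact: distortion_wr_H.
(* [wr_H 2] unfolds to the subgroup generated by [wr_b] and [comm wr_a wr_b], so both claims are the
   case p = 1, with the whole group read as [wr_H 1]. *)
split; last exact: (@distortion_wr_H 1).
rewrite -wr_H1; exact: (normal_wr_H 0).
Qed.
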